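(* Let $d\ge 2$ and let $F$ be the lowest open Lipschitz function. There exists $\alpha=\alpha(d,p)$ satisfying $\alpha(d,p)>0$ for $p>p_{\mathrm L}$ such that $$\mathbb P_p(F(0)>n)\le e^{-\alpha n},\qquad n\ge 0.$$
   Context: Let $\mathbb Z^+=\{1,2,\dots\}$ and let $\|\cdot\|$ be the $\ell^1$-norm. Site percolation on $\mathbb Z^d$ with parameter $p\in[0,1]$: each site is independently open with probability $p$ and closed otherwise; the law is $\mathbb P_p$. A function $F:\mathbb Z^{d-1}\to\mathbb Z^+$ is Lipschitz if $|F(x)-F(y)|\le 1$ for all $x,y\in\mathbb Z^{d-1}$ with $\|x-y\|=1$. A Lipschitz function $F:\mathbb Z^{d-1}\to\mathbb Z^+$ is called open if, for each $x\in\mathbb Z^{d-1}$, the site $(x,F(x))\in\mathbb Z^d$ is open. Let $\mathrm{LIP}$ be the event that an open Lipschitz function exists. This event is increasing and has $\mathbb P_p$-probability $0$ or $1$; $p_{\mathrm L}=p_{\mathrm L}(d)\in[0,1]$ is the number such that $\mathbb P_p(\mathrm{LIP})=0$ if $p<p_{\mathrm L}$ and $\mathbb P_p(\mathrm{LIP})=1$ if $p>p_{\mathrm L}$. The pointwise minimum of any nonempty family of Lipschitz functions is Lipschitz; hence if an open Lipschitz function exists there is a lowest one (the pointwise minimum of all open Lipschitz functions), called the lowest open Lipschitz function $F$. If no open Lipschitz function exists, the lowest open Lipschitz function is defined by $F(x)=\infty$ for all $x\in\mathbb Z^{d-1}$. *)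

(* Defs.v *)
From HB Require Import structures.
From mathcomp Require Import all_boot all_order all_algebra.
From mathcomp Require Import all_classical all_reals all_analysis.

Set Implicit Arguments.
Unset Strict Implicit.
Unset Printing Implicit Defensive.

Import Order.TTheory GRing.Theory Num.Theory.

Local Open Scope classical_set_scope.
Local Open Scope ring_scope.

(* The library norm on matrices is the sup norm. *)
Definition l1norm (n : nat) (x : 'rV[int]_n) : int := \sum_(i < n) `|x 0 i|.

(* Z^d, written as Z^(d-1) * Z so that (x, F x) is a site; only meaningful
   for 0 < d. *)
Definition site (d : nat) := ('rV[int]_d.-1 * int)%type.

(* The sigma-algebra on configurations is the product one, generated by the
   events "v is open"; [true] means open. *)
Definition open_site (d : nat) (v : site d) : set (site d -> bool) :=
  [set w | w v].

Definition config (d : nat) := g_sigma_algebraType (range (@open_site d)).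

Definition mutually_independent (R : realType) (disp : measure_display)
    (T : measurableType disp) (P : probability T R) (I : eqType)
    (E : I -> set T) : Prop :=
  forall s : seq I, uniq s ->
    (P (\big[setI/setT]_(i <- s) E i) = \prod_(i <- s) P (E i))%E.

(* This determines P, since the finite intersections of the events "v is open"
   form a pi-system generating the sigma-algebra of [config d]. *)
Definition site_percolation_law (R : realType) (d : nat) (p : R)
    (P : probability (config d) R) : Prop :=
  (forall v : site d, P (open_site v) = p%:E) /\
  mutually_independent P (@open_site d).

Definition latt_lipschitz (d : nat) (f : 'rV[int]_d.-1 -> int) : Prop :=
  forall x y : 'rV[int]_d.-1, l1norm (x - y) = 1 -> `|f x - f y| <= 1.

Definition open_lipschitz (d : nat) (w : config d) (f : 'rV[int]_d.-1 -> int) : Prop :=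
  [/\ forall x, 0 < f x, latt_lipschitz f & forall x, w (x, f x)].

Definition LIP (d : nat) : set (config d) :=
  [set w | exists f, open_lipschitz w f].
Arguments LIP : clear implicits.

(* The infimum is that of a set of positive integers, hence a minimum, unless
   there is no open Lipschitz function, in which case it is
   [ereal_inf set0 = +oo]. *)
Definition lowest_open_lipschitz (R : realType) (d : nat) (w : config d)
    (x : 'rV[int]_d.-1) : \bar R :=
  ereal_inf [set ((f x)%:~R)%:E | f in [set f | open_lipschitz w f]].

Definition is_pL (R : realType) (d : nat) (P : R -> probability (config d) R)
    (pL : R) : Prop :=
  0 <= pL <= 1 /\
  forall p : R, 0 <= p <= 1 ->
    (p < pL -> P p (LIP d) = 0%E) /\
    (pL < p -> P p (LIP d) = 1%E).

(* Main.v *)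
Require Import Defs.
From mathcomp Require Import all_boot all_order all_algebra.
From mathcomp Require Import all_classical all_reals all_analysis.
From mathcomp Require Import zify ring lra.

(** Exponential decay of the height of the lowest open Lipschitz function.

    Reversed admissible paths.  From a site, move for free to the site above it
    or to a site one level higher over a neighbouring column, and from a closed
    site also to the site just below it.  An open Lipschitz function that is at
    or below the starting point of such a path is at or below all its points.
    Hence [F 0 > n] exactly when some path from [(0, n)] reaches height [0]: if
    none does, the lowest heights from which height [0] is out of reach form an
    open Lipschitz function ([lowest_gtE]).  By translation invariance, the
    probability of this event is that of a path from the origin going down [n]
    levels ([probability_dive_shift]).  Let [D] be the greatest depth reached
    from the origin.

    Stochastic comparison.  Let [p2 < p] be two parameters above the threshold
    and [0 < t < 1].  Bias the law at [p2] by the factor [t ^ D], and explore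
    the reached sites one after the other.  If the next reached site turns out
    to be closed, the only new starting point is the site [u] below it, which
    raises [D] by at most one plus the depth reached from [u].  By the Harris
    inequality and translation invariance, this multiplies the conditional
    expectation of [t ^ D] by at least [t * c], where [c] is a lower bound for
    the expectation of [t ^ D].  So the biased law closes each explored site
    with conditional probability at least [(1 - p2) * (t * c)], and when this is
    at least [1 - p] it makes [D >= n] at least as likely as the law at [p] does
    ([comparison]).  On the other hand, the biased law gives [D >= n] a
    probability of at most [t ^ n / c], so this bounds its probability at [p]
    as well ([finite_tail]).

    Above the threshold [D] is almost surely finite, so that [c] tends to [1]
    as [t] does, and [t * c] can be made close enough to [1] ([dive_small]).
    The constant in front of [t ^ n] is absorbed by lowering the rate, because
    [D >= 1] does not have probability [1]: otherwise almost surely every site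
    would admit a path going down one level, paths could be continued for ever,
    and no open Lipschitz function would exist ([probability_dive1]).

    The comparison is made for finitely many random sites, all the others being
    open, and passes to the limit because a path is finite. *)

Set Implicit Arguments.
Unset Strict Implicit.
Unset Printing Implicit Defensive.

Import Order.TTheory GRing.Theory Num.Theory.
Import numFieldNormedType.Exports.

Local Open Scope classical_set_scope.
Local Open Scope ring_scope.

(** * Finite product measures *)

Section FiniteMean.
Context {R : realType} {I : eqType}.
Implicit Types (p : R) (s : seq I) (f g : (I -> bool) -> R) (w : I -> bool).

Definition upd w v b : I -> bool := fun x => if x == v then b else w x.

(** The expectation of [f] when the sites of [s] are independently open with
    probability [p] and the other sites are as in [w].  With a recursion on [s],
    conditioning on the state of one site is a computation. *)
Fixpoint mean p s f w : R :=
  if s is v :: s' then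
    p * mean p s' f (upd w v true) + (1 - p) * mean p s' f (upd w v false)
  else f w.

Definition le_config w w' := forall x, w x -> w' x.

Definition increasing f := forall w w', le_config w w' -> f w <= f w'.

Lemma updC w v x b c : v != x -> upd (upd w v b) x c = upd (upd w x c) v b.
Proof.
move=> vx; apply/funext => y; rewrite /upd.
by have [->|//] := eqVneq y x; rewrite eq_sym (negbTE vx).
Qed.

Lemma le_upd w w' v b : le_config w w' -> le_config (upd w v b) (upd w' v b).
Proof. by move=> ww x; rewrite /upd; case: ifP => // _; exact: ww. Qed.

Lemma upd_le w v : le_config (upd w v false) (upd w v true).
Proof. by move=> x; rewrite /upd; case: ifP. Qed.

Lemma eq_mean_off p s f g w :
  (forall w', (forall x, x \notin s -> w' x = w x) -> f w' = g w') ->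
  mean p s f w = mean p s g w.
Proof.
elim: s w => [|v s IHs] w fg /=; first exact: fg.
by congr (_ * _ + _ * _); apply: IHs => w' w'E; apply: fg => x;
  rewrite inE negb_or => /andP[xv xs]; rewrite w'E// /upd (negbTE xv).
Qed.

Lemma mean_cst p s c w : mean p s (fun=> c) w = c.
Proof. by elim: s w => //= v s IHs w; rewrite !IHs; ring. Qed.

Lemma meanZ p s c f w : mean p s (fun x => c * f x) w = c * mean p s f w.
Proof. by elim: s w => //= v s IHs w; rewrite !IHs; ring. Qed.

Lemma meanB p s f g w :
  mean p s (fun x => f x - g x) w = mean p s f w - mean p s g w.
Proof. by elim: s w => //= v s IHs w; rewrite !IHs; ring. Qed.

Lemma le_mean p s f g w : 0 <= p <= 1 -> (forall w', f w' <= g w') ->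
  mean p s f w <= mean p s g w.
Proof.
move=> /andP[p0 p1] fg; elim: s w => //= v s IHs w.
by rewrite lerD// ler_wpM2l// subr_ge0.
Qed.

Lemma mean_increasing p s f : 0 <= p <= 1 -> increasing f ->
  increasing (mean p s f).
Proof.
move=> /andP[p0 p1] inc; elim: s => //= v s IHs w w' ww.
by rewrite lerD// ler_wpM2l ?subr_ge0//; apply: IHs; exact: le_upd.
Qed.

Lemma mean_upd p s f w v b : v \notin s ->
  mean p s f (upd w v b) = mean p s (fun w' => f (upd w' v b)) w.
Proof.
elim: s w => //= x s IHs w; rewrite inE negb_or => /andP[vx vs].
by rewrite !(updC _ _ _ vx) !IHs.
Qed.

(** The sites can be revealed in any order, so that an exploration may choose
    the next one. *)
Lemma mean_rem p s f w v : v \in s ->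
  mean p s f w = p * mean p (rem v s) f (upd w v true) +
                 (1 - p) * mean p (rem v s) f (upd w v false).
Proof.
elim: s w => //= x s IHs w; rewrite inE eq_sym; case: eqVneq => [->//|xv /= vs].
by rewrite !IHs// !(@updC _ x v)//; ring.
Qed.

(** Conditioning on one site at a time leaves Chebyshev's inequality for two
    increasing functions on a two-point probability space. *)
Lemma harris p s f g w : 0 <= p <= 1 -> increasing f -> increasing g ->
  mean p s f w * mean p s g w <= mean p s (fun w' => f w' * g w') w.
Proof.
move=> p01 fi gi; elim: s w => //= v s IHs w.
have /andP[p0 p1] := p01.
have fv := mean_increasing s p01 fi (@upd_le w v).
have gv := mean_increasing s p01 gi (@upd_le w v).
have q0 : 0 <= 1 - p by rewrite subr_ge0.
apply: le_trans (lerD (ler_wpM2l p0 (IHs _)) (ler_wpM2l q0 (IHs _))).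
move: fv gv; set a := mean _ _ f _; set b := mean _ _ f _.
set c := mean _ _ g _; set e := mean _ _ g _ => ab ce.
rewrite -subr_ge0.
have -> : p * (b * e) + (1 - p) * (a * c)
   - (p * b + (1 - p) * a) * (p * e + (1 - p) * c)
   = p * (1 - p) * ((b - a) * (e - c)) by ring.
by rewrite !mulr_ge0 ?subr_ge0.
Qed.

End FiniteMean.

Lemma mean_map {R : realType} {I J : eqType} (p : R) (h : I -> J) (s : seq I)
    (f : (I -> bool) -> R) (w : J -> bool) : injective h ->
  mean p (map h s) (fun w' => f (w' \o h)) w = mean p s f (w \o h).
Proof.
move=> hi; elim: s w => //= v s IHs w; rewrite !IHs.
have E b : upd w (h v) b \o h = upd (w \o h) v b.
  by apply/funext => x /=; rewrite /upd (inj_eq hi).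
by rewrite !E.
Qed.

(** * Reversed admissible paths *)

Section Geometry.
Context {d : nat}.
Implicit Types (K : site d -> Prop) (w : site d -> bool) (v u : site d).
Implicit Types (h : int).

(** The end points of the reversed admissible paths from [K].  Sideways steps
    are free because a Lipschitz function rises by at most one between
    neighbouring columns; a closed site can be left downwards because an open
    function that is at or below it is strictly below it. *)
Inductive reach K w : site d -> Prop :=
| reach_start v : K v -> reach K w v
| reach_up x k : reach K w (x, k) -> reach K w (x, k + 1)
| reach_side x y k : reach K w (x, k) -> l1norm (x - y) = 1 ->
    reach K w (y, k + 1)
| reach_down x k : reach K w (x, k) -> ~~ w (x, k) -> reach K w (x, k - 1).

Definition below v : site d := (v.1, v.2 - 1).

Definition hits K w h := exists2 v, reach K w v & v.2 <= h.

Definition all_open : site d -> bool := fun=> true.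

Definition extend K u : site d -> Prop := fun x => K x \/ x = u.

Lemma reach_below K w v : reach K w v -> ~~ w v -> reach K w (below v).
Proof. by case: v => x k; exact: reach_down. Qed.

Lemma reach_trans K K' w v : (forall u, K u -> reach K' w u) ->
  reach K w v -> reach K' w v.
Proof.
move=> KK'; elim=> [u /KK'//|x k _|x y k _ + xy|x k _ + xk].
- exact: reach_up.
- by move=> /reach_side; exact.
- by move=> /reach_down; exact.
Qed.

Lemma hits_trans K K' w h : (forall u, K u -> reach K' w u) ->
  hits K w h -> hits K' w h.
Proof. by move=> KK' [v vK vh]; exists v => //; exact: reach_trans vK. Qed.

Lemma reach_sub K w w' v : le_config w' w -> reach K w v -> reach K w' v.
Proof.
move=> ww; elim=> [u /reach_start//|x k _|x y k _ + xy|x k _ + xk].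
- exact: reach_up.
- by move=> /reach_side; exact.
- by move=> /reach_down; apply; apply: contra xk; exact: ww.
Qed.

Lemma hits_sub K w w' h : le_config w' w -> hits K w h -> hits K w' h.
Proof. by move=> ww [v vK vh]; exists v => //; exact: reach_sub vK. Qed.

Lemma hits_le K w h h' : h <= h' -> hits K w h -> hits K w h'.
Proof. by move=> hh [v ? vh]; exists v => //; exact: le_trans hh. Qed.

Lemma reach_extend K u w v :
  reach (extend K u) w v -> reach K w v \/ reach (eq^~ u) w v.
Proof.
elim=> {v} [v [Kv|->]|x k _ [] H|x y k _ [] H xy|x k _ [] H xk];
  try (by left; exact: reach_start); try (by right; exact: reach_start);
  try (by left; exact: reach_up); try (by right; exact: reach_up);
  try (by left; exact: reach_side xy); try (by right; exact: reach_side xy);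
  try (by left; exact: reach_down); by right; exact: reach_down.
Qed.

Lemma hits_extend K u w h :
  hits (extend K u) w h -> hits K w h \/ hits (eq^~ u) w h.
Proof. by case=> v /reach_extend[H|H] vh; [left|right]; exists v. Qed.

(** Closing a site [v] reached without the help of any closed site amounts to
    adding the site below [v] to the starting points, whatever the state of [v]
    in [w].  This keeps the explored sites out of the configuration. *)
Lemma reach_upd K w v : reach K all_open v ->
  reach K (upd w v false) = reach (extend K (below v)) w.
Proof.
move=> Kv; apply/funext => u; apply/propext; split.
  elim=> [{}u Ku|x k _|x y k _ + xy|x k _ + xk].
  - by apply: reach_start; left.
  - exact: reach_up.
  - by move=> /reach_side; exact.
  - move: xk; rewrite /upd; case: ifP => [/eqP vE _ _|_ xk].
      by apply: reach_start; right; rewrite -vE.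
    by move=> /reach_down; exact.
have Kv' : reach K (upd w v false) v by apply: reach_sub Kv.
elim=> [{}u [Ku| ->]|x k _|x y k _ + xy|x k _ + xk].
- exact: reach_start.
- by apply: reach_below => //; rewrite /upd eqxx.
- exact: reach_up.
- by move=> /reach_side; exact.
- by move=> /reach_down; apply; rewrite /upd; case: ifP.
Qed.

Lemma hits_upd K w v h : reach K all_open v ->
  hits K (upd w v false) h = hits (extend K (below v)) w h.
Proof. by move=> Kv; rewrite /hits reach_upd. Qed.

(** The exploration is over: no random site is reached, so that their states do
    not matter. *)
Lemma reach_off K w (s : seq (site d)) :
  (forall x, x \notin s -> w x) ->
  (forall x, x \in s -> ~ reach K all_open x) ->
  reach K w = reach K all_open.
Proof.
move=> ws sK; apply/funext => u; apply/propext; split; last exact: reach_sub.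
elim=> [{}u Ku|x k _|x y k _ + xy|x k _ + xk].
- exact: reach_start.
- exact: reach_up.
- by move=> /reach_side; exact.
- have /sK xK: (x, k) \in s by apply: contraT => /ws; rewrite (negbTE xk).
  by move=> /xK.
Qed.

Context (n : nat).

(** The number of levels below [h0] that are reached, truncated at [n]: the
    truncation makes the maximum finite and does not affect whether [n] levels
    are reached. *)
Definition depth K h0 w : nat :=
  \max_(k < n.+1 | `[< hits K w (h0 - k%:Z) >]) k.

Lemma leq_depth K h0 w k : (k <= n)%N -> hits K w (h0 - k%:Z) ->
  (k <= depth K h0 w)%N.
Proof.
move=> kn H; have kn' : (k < n.+1)%N by [].
by rewrite (@leq_bigmax_cond _ (fun k : 'I_n.+1 => `[< hits K w (h0 - k%:Z) >])
  (fun k => k : nat) (Ordinal kn'))//; apply/asboolP.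
Qed.

Lemma depth_hits K h0 w : (0 < depth K h0 w)%N ->
  hits K w (h0 - (depth K h0 w)%:Z).
Proof.
rewrite /depth.
set P := fun k : 'I_n.+1 => `[< hits K w (h0 - k%:Z) >].
case: (pickP P) => [i Pi _|P0]; last by rewrite big_pred0.
have P0 : (0 < #|P|)%N by apply/card_gt0P; exists i.
have [j Pj ->] := @eq_bigmax_cond _ P (fun k => k : nat) P0.
exact/asboolP.
Qed.

Lemma depth_sub K h0 w w' : le_config w w' -> (depth K h0 w' <= depth K h0 w)%N.
Proof.
move=> ww; apply/bigmax_leqP => k /asboolP H.
by apply: leq_depth; [rewrite -ltnS|exact: hits_sub H].
Qed.

(** The site below [v] is at most one level deeper than what is reached
    already, whether or not [v] lies below the reference height [h0]. *)
Lemma depth_extend K h0 w v : reach K all_open v ->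
  (depth (extend K (below v)) h0 w <=
   depth K h0 w + (depth (eq^~ (below v)) (below v).2 w).+1)%N.
Proof.
move=> Kv; apply/bigmax_leqP => k /asboolP /hits_extend[H|H].
  by apply: leq_trans (leq_addr _ _); apply: leq_depth; [rewrite -ltnS|].
have kn : (k <= n)%N by rewrite -ltnS.
have Kv' : reach K w v by apply: reach_sub Kv.
case: (lerP v.2 (h0 - k%:Z)) => [vk|kv].
  by apply: leq_trans (leq_addr _ _); apply: leq_depth => //; exists v.
case: (ltrP h0 v.2) => [h0v|vh0].
  apply: leq_trans (leq_addl _ _); apply: leqW; apply: leq_depth => //.
  by apply: hits_le H; rewrite lerD2r /below /=; lia.
(* the site [v] itself lies [e] levels below the reference height *)
pose e := `|h0 - v.2|%N; pose j := (k - e.+1)%N.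
have eE : e%:Z = h0 - v.2 by rewrite /e; lia.
have ek : (e < k)%N by lia.
have jE : j%:Z = k%:Z - e%:Z - 1 by rewrite /j; lia.
rewrite (_ : nat_of_ord k = (e + j.+1)%N); last by rewrite /j; lia.
apply: leq_add.
  by apply: leq_depth; [exact: leq_trans (ltnW ek) kn|exists v => //; lia].
rewrite ltnS; apply: leq_depth; first by rewrite /j; lia.
by rewrite jE eE /=; apply: hits_le H; lia.
Qed.
End Geometry.

(** * Comparison of two parameters *)

Section Comparison.
Context {R : realType} {d : nat}.
Implicit Types (K : site d -> Prop) (w : site d -> bool) (v u : site d).
Implicit Types (s : seq (site d)).

Definition hit K (h : int) w : R := `[< hits K w h >]%:R.

Lemma hit_ge0 K h w : 0 <= hit K h w.
Proof. by rewrite /hit; case: asbool. Qed.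

Lemma le_hit K K' h h' w w' : (hits K w h -> hits K' w' h') ->
  hit K h w <= hit K' h' w'.
Proof.
move=> H; rewrite /hit; case: asboolP => [/H Hh|_]; last by case: asbool.
by rewrite asboolT.
Qed.

Context (p p' t c : R) (n : nat) (h0 : int).
Context (p01 : 0 <= p <= 1) (p'01 : 0 <= p' <= 1) (t01 : 0 <= t <= 1).

Definition weight K h w : R := t ^+ depth n K h w.

Lemma weight_ge0 K h w : 0 <= weight K h w.
Proof. by rewrite exprn_ge0//; case/andP: t01. Qed.

Lemma weight_increasing K h : increasing (weight K h).
Proof.
move=> w w' ww; case/andP: t01 => t0 t1.
by rewrite ler_wiXn2l//; exact: depth_sub.
Qed.

Lemma weight_hit K w : weight K h0 w * hit K (h0 - n%:Z) w <= t ^+ n.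
Proof.
case/andP: t01 => t0 t1.
rewrite /hit; case: asboolP => [H|_]; last by rewrite mulr0 exprn_ge0.
by rewrite mulr1 ler_wiXn2l//; exact: leq_depth.
Qed.

Context (c_mean : forall u s, uniq s ->
  c <= mean p s (weight (eq^~ u) u.2) all_open).
Context (p'_large : 1 - p' <= (1 - p) * (t * c)).

(** The weights from the old starting points and from the new one are both
    increasing, hence positively correlated. *)
Lemma mean_weight_extend K s v : uniq s -> reach K all_open v ->
  t * c * mean p s (weight K h0) all_open <=
  mean p s (weight (extend K (below v)) h0) all_open.
Proof.
move=> us Kv; case/andP: t01 => t0 t1.
set u := below v.
have W0 : 0 <= mean p s (weight K h0) all_open.
  rewrite -(mean_cst p s 0 all_open); apply: le_mean => // w.
  exact: weight_ge0.
apply: (@le_trans _ _ (mean p s (fun w => t * (weight K h0 w *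
    weight (eq^~ u) u.2 w)) all_open)).
  rewrite meanZ -mulrA ler_wpM2l//.
  apply: le_trans
    (harris _ _ p01 (weight_increasing _ _) (weight_increasing _ _)).
  by rewrite mulrC ler_wpM2l// c_mean.
apply: le_mean => // w.
by rewrite -exprD -exprS -addnS ler_wiXn2l//; exact: depth_extend.
Qed.

(** After division by the mean weight, this compares the probabilities of the
    same event under the law with parameter [p'] and under the law with
    parameter [p] biased by the weight.  The induction reveals the sites of an
    exploration from [K]: under the biased law a revealed site is closed with
    conditional probability at least [(1 - p) * (t * c)]. *)
Lemma comparison s K : uniq s ->
  mean p' s (hit K (h0 - n%:Z)) all_open * mean p s (weight K h0) all_open <=
  mean p s (fun w => weight K h0 w * hit K (h0 - n%:Z) w) all_open.
Proof.
case/andP: t01 => t0 t1; case/andP: p01 => p0 p1; case/andP: p'01 => p'0 p'1.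
have [m] := ubnP (size s); elim: m s K => // m IHm s K sm us.
case: (pselect (exists2 v, v \in s & reach K all_open v)) => [[v vs Kv]|nos];
  last first.
  have offE w : (forall x, x \notin s -> w x = all_open x) ->
      reach K w = reach K all_open.
    move=> wE; apply: (reach_off (s := s)) => x xs; first by rewrite wE.
    by move=> xK; apply: nos; exists x.
  have hE w : (forall x, x \notin s -> w x = all_open x) ->
      forall h, hits K w h = hits K all_open h.
    by move=> wE h; rewrite /hits offE.
  have wE w : (forall x, x \notin s -> w x = all_open x) ->
      weight K h0 w = weight K h0 all_open.
    move=> H; rewrite /weight /depth; congr (t ^+ _).
    by apply: eq_bigl => k; rewrite hE.
  rewrite (@eq_mean_off _ _ p' s _ (fun=> hit K (h0 - n%:Z) all_open));
    last first.
    by move=> w H; rewrite /hit (hE w H).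
  rewrite (@eq_mean_off _ _ p s (weight K h0) (fun=> weight K h0 all_open))//.
  rewrite (@eq_mean_off _ _ p s (fun w => _ * _)
    (fun=> weight K h0 all_open * hit K (h0 - n%:Z) all_open)); last first.
    by move=> w H; rewrite (wE w H) /hit (hE w H).
  by rewrite !mean_cst mulrC.
rewrite !(mean_rem _ _ _ vs).
have us' : uniq (rem v s) by exact: rem_uniq.
have vs' : v \notin rem v s by rewrite mem_rem_uniqF.
have sm' : (size (rem v s) < m)%N.
  by rewrite size_rem// -ltnS prednK//; case: (s) vs.
have openE : upd (@all_open d) v true = all_open.
  by apply/funext => x; rewrite /upd; case: ifP.
rewrite openE !mean_upd//.
have hE h : (fun w => hit K h (upd w v false)) = hit (extend K (below v)) h.
  by apply/funext => w; rewrite /hit hits_upd.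
have wE : (fun w => weight K h0 (upd w v false)) =
  weight (extend K (below v)) h0.
  apply/funext => w; rewrite /weight /depth; congr (t ^+ _).
  by apply: eq_bigl => k; rewrite hits_upd.
have -> : (fun w => weight K h0 (upd w v false) *
    hit K (h0 - n%:Z) (upd w v false)) =
    (fun w => weight (extend K (below v)) h0 w *
      hit (extend K (below v)) (h0 - n%:Z) w).
  by apply/funext => w; rewrite -hE -wE.
rewrite hE wE.
have K_extend w h : hits K w h -> hits (extend K (below v)) w h.
  by apply: hits_trans => x Kx; apply: reach_start; left.
(* [a], [b] are the mean weights and [A], [B] the probabilities of the event
   when [v] is closed, respectively open *)
have := IHm (rem v s) K sm' us'.
have := IHm (rem v s) (extend K (below v)) sm' us'.
have := mean_weight_extend us' Kv.
have : mean p (rem v s) (weight (extend K (below v)) h0) all_open <=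
       mean p (rem v s) (weight K h0) all_open.
  apply: le_mean => // w; rewrite ler_wiXn2l//.
  apply/bigmax_leqP => k /asboolP H.
  by apply: leq_depth; [rewrite -ltnS|exact: K_extend].
have : mean p' (rem v s) (hit K (h0 - n%:Z)) all_open <=
       mean p' (rem v s) (hit (extend K (below v)) (h0 - n%:Z)) all_open.
  by apply: le_mean => // w; apply: le_hit; exact: K_extend.
have : 0 <= mean p (rem v s) (weight K h0) all_open.
  rewrite -(mean_cst p (rem v s) 0 all_open); apply: le_mean => // w.
  exact: weight_ge0.
set a := mean p _ (weight (extend _ _) _) _; set b := mean p _ (weight _ _) _.
set B := mean p' _ (hit K _) _; set A := mean p' _ _ _.
set Y := mean _ _ _ _; set X := mean _ _ _ _.
move=> b0 BA ab tcb AaX BbY.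
apply: (@le_trans _ _ (p * (B * b) + (1 - p) * (A * a))); last first.
  by rewrite lerD// ler_wpM2l// subr_ge0.
rewrite -subr_ge0.
have -> : p * (B * b) + (1 - p) * (A * a) -
    (p' * B + (1 - p') * A) * (p * b + (1 - p) * a) =
    (A - B) * ((1 - p) * a - (1 - p') * (p * b + (1 - p) * a)) by ring.
rewrite mulr_ge0 ?subr_ge0//.
apply: (@le_trans _ _ ((1 - p') * b)).
  rewrite ler_wpM2l ?subr_ge0//.
  rewrite -subr_ge0 (_ : _ - _ = (1 - p) * (b - a)); last by ring.
  by rewrite mulr_ge0 ?subr_ge0.
apply: le_trans (ler_wpM2r b0 p'_large) _.
by rewrite -mulrA ler_wpM2l// subr_ge0.
Qed.

End Comparison.

(** Since the weight is at least [t ^+ m] unless [m.+1] levels are reached, its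
    mean is at least [t ^+ m * (1 - eps)]. *)
Lemma finite_tail {R : realType} {d : nat} (p p' t eps : R) (m n : nat)
    (s : seq (site d)) (u : site d) :
  0 <= p <= 1 -> 0 <= p' <= 1 -> 0 <= t <= 1 -> eps <= 1 ->
  (forall (u : site d) (s : seq (site d)), uniq s ->
     mean p s (hit (eq^~ u) (u.2 - m.+1%:Z)) all_open <= eps) ->
  1 - p' <= (1 - p) * (t ^+ m.+1 * (1 - eps)) ->
  uniq s ->
  mean p' s (hit (eq^~ u) (u.2 - n%:Z)) all_open * (t ^+ m * (1 - eps)) <=
  t ^+ n.
Proof.
move=> p01 p'01 t01 eps1 heps hp' us.
have /andP[t0 t1] := t01.
have cmean (u' : site d) (s' : seq (site d)) : uniq s' ->
    t ^+ m * (1 - eps) <= mean p s' (weight t n (eq^~ u') u'.2) all_open.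
  move=> us'.
  apply: (@le_trans _ _ (mean p s' (fun w => t ^+ m *
      (1 - hit (eq^~ u') (u'.2 - m.+1%:Z) w)) all_open)).
    rewrite meanZ meanB mean_cst ler_wpM2l ?exprn_ge0//.
    by rewrite lerD2l lerN2 heps.
  apply: le_mean => // w.
  rewrite /hit; case: asboolP => [_|nh].
    by rewrite subrr mulr0 weight_ge0.
  rewrite subr0 mulr1 ler_wiXn2l// leqNgt; apply/negP => mD; apply: nh.
  apply: hits_le (depth_hits (leq_trans _ mD)) => //.
  by rewrite lerD2l lerN2 lez_nat.
have hp'' : 1 - p' <= (1 - p) * (t * (t ^+ m * (1 - eps))).
  by rewrite (mulrA t) -exprS.
apply: (@le_trans _ _ (mean p' s (hit (eq^~ u) (u.2 - n%:Z)) all_open *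
    mean p s (weight t n (eq^~ u) u.2) all_open)).
  rewrite ler_wpM2l ?cmean//.
  rewrite -(mean_cst p' s 0 all_open); apply: le_mean => // w; exact: hit_ge0.
apply: le_trans (comparison u.2 p01 p'01 t01 cmean hp'' _ us) _.
rewrite -(mean_cst p s (t ^+ n) all_open); apply: le_mean => // w.
exact: weight_hit.
Qed.

(** * Paths and open Lipschitz functions *)

Lemma l1normN n (x : 'rV[int]_n) : l1norm (- x) = l1norm x.
Proof. by apply: eq_bigr => i _; rewrite mxE normrN. Qed.

Lemma l1norm_axis n (c : int) (i : 'I_n) :
  l1norm (c *: delta_mx 0 i : 'rV[int]_n) = `|c|.
Proof.
rewrite /l1norm (bigD1 i)//= !mxE !eqxx mulr1 big1 ?addr0// => j ji.
by rewrite !mxE (negbTE ji) andbF mulr0 normr0.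
Qed.

Lemma lattice_ind n (Q : 'rV[int]_n -> Prop) : Q 0 ->
  (forall x y, l1norm (x - y) = 1 -> Q x -> Q y) -> forall x, Q x.
Proof.
move=> Q0 Qstep x.
have Qline (y : 'rV[int]_n) i (k : int) : Q y -> Q (k *: delta_mx 0 i + y).
  move=> Qy; elim/int_rect: k => [|k IHk|k IHk]; first by rewrite scale0r add0r.
    apply: Qstep IHk; rewrite opprD addrACA subrr addr0 -scalerBl.
    by rewrite l1norm_axis; lia.
  apply: Qstep IHk; rewrite opprD addrACA subrr addr0 -scalerBl.
  by rewrite l1norm_axis; lia.
rewrite (row_sum_delta x); elim/big_rec: _ => // i y _; exact: Qline.
Qed.

Section Surfaces.
Context {d : nat}.
Implicit Types (w : config d) (f : 'rV[int]_d.-1 -> int).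

Definition grounded w (v : site d) := hits (eq^~ v) w 0.

Lemma grounded_step w u v : reach (eq^~ v) w u -> grounded w u -> grounded w v.
Proof. by move=> uv; apply: hits_trans => _ ->. Qed.

Lemma open_lipschitz_reach w f v u : open_lipschitz w f ->
  reach (eq^~ v) w u -> f v.1 <= v.2 -> f u.1 <= u.2.
Proof.
move=> [_ fL fw] vu vf; elim: vu =>
  [_ ->//|x k _ /= xk|x y k _ /= xk xy|x k _ /= xk].
- by rewrite (le_trans xk)// lerDl.
- have := fL _ _ xy; lia.
- move=> wk; have : f x != k by apply: contraNneq wk => <-; exact: fw.
  by lia.
Qed.

Lemma grounded_lt w f x k : open_lipschitz w f -> grounded w (x, k) -> k < f x.
Proof.
move=> fw [u xu u0]; rewrite ltNge; apply/negP => fk.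
have := open_lipschitz_reach fw xu fk.
by case: fw => f0 _ _; have := f0 u.1; lia.
Qed.

(** The lowest heights that are not grounded form an open Lipschitz function.
    They are finite over every column as soon as they are over one, because a
    sideways step changes the height by one. *)
Lemma open_lipschitz_below w (n : nat) : ~ grounded w (0, n%:Z) ->
  exists2 f, open_lipschitz w f & f 0 <= n%:Z.
Proof.
move=> w0.
have bounded x : exists k : nat, ~~ `[< grounded w (x, k%:Z) >].
  elim/lattice_ind: x => [|x y xy [k /asboolPn nk]].
    by exists n; apply/asboolPn.
  exists k.+1; apply/asboolPn; apply: contra_not nk; apply: grounded_step.
  have -> : k.+1%:Z = k%:Z + 1 by lia.
  apply: reach_side xy; exact: reach_start.
exists (fun x => (ex_minn (bounded x))%:Z); last first.
  by case: ex_minnP => m _ mP; rewrite lez_nat mP//; apply/asboolPn.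
split.
- move=> x; case: ex_minnP => -[|//] /asboolPn [].
  by exists (x, 0) => //; exact: reach_start.
- have le1 x y : l1norm (x - y) = 1 ->
      (ex_minn (bounded y) <= (ex_minn (bounded x)).+1)%N.
    move=> xy; case: (ex_minnP (bounded y)) => m _; apply.
    case: ex_minnP => k /asboolPn nk _; apply/asboolPn.
    apply: contra_not nk; apply: grounded_step.
    have -> : k.+1%:Z = k%:Z + 1 by lia.
    apply: reach_side xy; exact: reach_start.
  move=> x y xy; have := le1 _ _ xy.
  have := le1 y x; rewrite -l1normN opprB => /(_ xy).
  by lia.
- move=> x; case: ex_minnP => -[/asboolPn [] |m /asboolPn nm mP].
    by exists (x, 0) => //; exact: reach_start.
  apply: contraT => wm; exfalso; apply: nm.
  have /asboolP gm : `[< grounded w (x, m%:Z) >].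
    by apply: contraT => /mP; rewrite ltnn.
  apply: grounded_step gm.
  have -> : m%:Z = m.+1%:Z - 1 by lia.
  by apply: reach_down => //; exact: reach_start.
Qed.

Lemma lowest_gtE (R : realType) (n : nat) :
  [set w | ((n%:R)%:E < lowest_open_lipschitz R w (0 : 'rV[int]_d.-1))%E] =
  [set w | grounded w (0, n%:Z)].
Proof.
apply/seteqP; split=> w /=.
  move=> nF; apply: contrapT => /open_lipschitz_below [f fw fn].
  move: nF; rewrite ltNge => /negP; apply.
  apply: le_trans (ereal_inf_lbound _) _; first by exists f; [exact: fw|].
  by rewrite lee_fin -[n%:R]/(n%:Z%:~R) ler_int.
move=> gw; apply: (@lt_le_trans _ _ (n.+1%:R)%:E);
  first by rewrite lte_fin ltr_nat.
apply: le_ereal_inf_tmp => _ [f fw <-].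
by rewrite lee_fin -[n.+1%:R]/(n.+1%:Z%:~R) ler_int; exact: grounded_lt gw.
Qed.

Lemma LIPE : LIP d = \bigcup_(n : nat) [set w | ~ grounded w (0, n%:Z)].
Proof.
apply/seteqP; split=> w.
  move=> [f fw]; exists `|f 0%R|%N => // gw.
  by have := grounded_lt fw gw; case: fw => /(_ 0) f0 _ _; lia.
by move=> [n _ /open_lipschitz_below [f fw _]]; exists f.
Qed.

End Surfaces.

(** * Probabilities of cylinder events *)

Section Cylinders.
Context {R : realType} {d : nat}.
Implicit Types (s r : seq (site d)) (A : set (config d)).

Definition determined_by s A := forall w w' : config d,
  (forall x, x \in s -> w x = w' x) -> A w -> A w'.

Lemma measurable_open_site (v : site d) :
  measurable (@open_site d v : set (config d)).
Proof. by apply: sub_sigma_algebra; exists v. Qed.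

Lemma determined_upd v s A b : determined_by (v :: s) A ->
  determined_by s [set w | A (upd w v b)].
Proof.
move=> As w w' ww; apply: As => x; rewrite inE /upd.
by case: eqVneq => //= _; exact: ww.
Qed.

Lemma split_site (A : set (config d)) (v : site d) :
  A = ([set w | A (upd w v true)] `&` open_site v) `|`
      ([set w | A (upd w v false)] `\` open_site v).
Proof.
have updE (w : config d) : upd w v (w v) = w.
  by apply/funext => x; rewrite /upd; case: eqVneq => [->|].
apply/seteqP; split=> w /=; rewrite /open_site /=.
  by move=> Aw; case wv: (w v); [left|right]; split=> //; rewrite -wv updE.
case=> -[Aw]; first by move=> wv; rewrite -(updE w) wv.
by move=> /negP /negbTE wv; rewrite -(updE w) wv.
Qed.

Lemma determined_measurable s A : determined_by s A -> measurable A.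
Proof.
elim: s A => [|v s IHs] A As.
  have [->|/set0P [w Aw]] := eqVneq A set0; first exact: measurable0.
  by rewrite (_ : A = setT)//; apply/seteqP; split=> // w' _; exact: As Aw.
rewrite (split_site A v).
apply: measurableU; [apply: measurableI|apply: measurableD];
  try exact: measurable_open_site; by apply: IHs; exact: determined_upd.
Qed.

Context (p : R) (P : probability (config d) R).
Context (hP : site_percolation_law p P).

(** The independence assumption only concerns events that some sites are open.
    The case of a closed site follows by subtraction, which requires carrying
    along a list [r] of sites that are open. *)
Lemma probability_cylinder_open s r A (w : site d -> bool) :
  uniq (s ++ r) -> determined_by s A ->
  P (A `&` \big[setI/setT]_(x <- r) open_site x) =
  (mean p s (fun w' => `[< A w' >]%:R) w * p ^+ size r)%:E.
Proof.
case: hP => P1 Pind.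
have mr r' : measurable (\big[setI/setT]_(x <- r') open_site x :
  set (config d)).
  elim: r' => [|x r' IHr]; first by rewrite big_nil; exact: measurableT.
  by rewrite big_cons; apply: measurableI => //; exact: measurable_open_site.
elim: s r A w => [|v s IHs] r A w us As.
  have [Aw|nAw] := pselect (A w); rewrite /=.
    rewrite asboolT// mul1r (_ : A = setT) ?setTI; last first.
      by apply/seteqP; split=> // w' _; exact: As Aw.
    rewrite Pind//; elim: r {us} => [|x r IHr]; first by rewrite big_nil.
    by rewrite big_cons IHr P1 /= exprS EFinM.
  rewrite asboolF// mul0r (_ : A = set0) ?set0I ?measure0//.
  by apply/seteqP; split=> // w' Aw'; apply: nAw; exact: As Aw'.
have uvsr : uniq (s ++ v :: r).
  by rewrite (perm_uniq (_ : perm_eq _ (v :: s ++ r)))//;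
    rewrite perm_catC /= perm_cons perm_catC.
have usr : uniq (s ++ r) by move: us => /= /andP[].
have vs : v \notin s.
  by move: us => /=; rewrite mem_cat negb_or => /andP[/andP[]].
set T : set (config d) := \big[setI/setT]_(x <- r) _.
pose A1 : set (config d) := [set w' | A (upd w' v true)].
pose A0 : set (config d) := [set w' | A (upd w' v false)].
have A1s : determined_by s A1 by exact: determined_upd.
have A0s : determined_by s A0 by exact: determined_upd.
have mT : measurable T by exact: mr.
have mA1 := determined_measurable A1s.
have mA0 := determined_measurable A0s.
have mv := measurable_open_site v.
have -> : A `&` T =
    (A1 `&` (open_site v `&` T)) `|` ((A0 `&` T) `\` open_site v).
  rewrite {1}(split_site A v) setIUl -setIA; congr (_ `|` _).
  by rewrite !setDE -!setIA (setIC T).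
rewrite measureU//; first last.
- by apply/seteqP; split=> // x [[_ [xv _]] [_]].
- by apply: measurableD => //; exact: measurableI.
- by apply: measurableI => //; exact: measurableI.
rewrite measureD//; first last.
- by rewrite ltey_eq fin_num_measure//; exact: measurableI.
- exact: measurableI.
rewrite -setIA (setIC T).
have E1 := IHs _ _ (upd w v true) uvsr A1s.
have E0 := IHs _ _ (upd w v false) uvsr A0s.
have E2 := IHs _ _ (upd w v false) usr A0s.
rewrite big_cons in E1 E0.
pose m1 := mean p s (fun w' => `[< A1 w' >]%:R) (upd w v true).
pose m0 := mean p s (fun w' => `[< A0 w' >]%:R) (upd w v false).
transitivity ((m1 * p ^+ (size r).+1)%:E +
    ((m0 * p ^+ size r)%:E - (m0 * p ^+ (size r).+1)%:E))%E.
  by congr (_ + (_ - _))%E; [exact: E1|exact: E2|exact: E0].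
rewrite -EFinB -EFinD; congr EFin.
rewrite /m1 /m0 /= !(mean_upd _ _ _ _ vs).
have updK (w' : config d) b c : upd (upd w' v c) v b = upd w' v b.
  by apply/funext => x; rewrite /upd; case: (x == v).
have updE b c : (fun w' => `[< A (upd (upd w' v c) v b) >]%:R) =
    (fun w' => `[< A (upd w' v b) >]%:R : R).
  by apply/funext => w'; rewrite updK.
rewrite /A1 /A0 /= !updE.
rewrite exprS; ring.
Qed.

Lemma probability_cylinder s A (w : site d -> bool) :
  uniq s -> determined_by s A ->
  P A = (mean p s (fun w' => `[< A w' >]%:R) w)%:E.
Proof.
move=> us As; have := @probability_cylinder_open s [::] A w.
by rewrite cats0 big_nil setIT mulr1; exact.
Qed.

End Cylinders.

(** * Translation invariance and infinite volume *)

Section Translation.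
Context {d : nat}.
Implicit Types (K : site d -> Prop) (w : site d -> bool) (v u : site d).
Implicit Types (h : int).

Lemma reach_shift K w v u :
  reach K w u -> reach (K \o +%R v) (w \o +%R v) (u - v).
Proof.
elim=> {u} [u Ku|x k _|x y k _ + xy|x k _ + xk].
- by apply: reach_start; rewrite /= addrC subrK.
- move=> /reach_up; rewrite (_ : (x - v.1, k - v.2 + 1) = (x, k + 1) - v)//.
  by congr pair => /=; lia.
- move=> /(@reach_side d _ _ _ (y - v.1)).
  rewrite (_ : (y - v.1, k - v.2 + 1) = (y, k + 1) - v); last first.
    by congr pair => /=; lia.
  by apply; rewrite opprB addrA subrK.
- move=> /reach_down; rewrite (_ : (x - v.1, k - v.2 - 1) = (x, k - 1) - v);
    last first.
    by congr pair => /=; lia.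
  apply; rewrite (_ : (x - v.1, k - v.2) = (x, k) - v)//.
  by rewrite /= addrC subrK.
Qed.

Lemma hits_shift w v h : hits (eq^~ v) w h =
  hits (eq^~ 0) (w \o +%R v) (h - v.2).
Proof.
apply/propext; split=> -[u vu uh].
  exists (u - v); last by rewrite lerD2r.
  apply: reach_trans (reach_shift v vu) => x /= vx.
  by apply: reach_start; apply: (addrI v); rewrite addr0.
exists (u + v); last by move: uh; rewrite lerBrDr.
have := reach_shift (- v) vu; rewrite opprK.
have -> : (w \o +%R v) \o +%R (- v) = w.
  by apply/funext => x /=; rewrite addrA subrr add0r.
apply: reach_trans => x /= vx.
by apply: reach_start; apply: (addrI (- v)); rewrite vx addNr.
Qed.

Lemma mean_shift (R : realType) (p : R) (s : seq (site d)) v (m : int) :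
  mean p (map (+%R v) s) (hit (eq^~ v) (v.2 - m)) all_open =
  mean p s (hit (eq^~ 0) (0 - m)) all_open.
Proof.
rewrite -(mean_map p s (hit (eq^~ 0) (0 - m)) all_open (addrI v)).
congr (mean _ _ _ _); apply/funext => w.
by rewrite /hit hits_shift addrAC subrr.
Qed.

End Translation.

Section Boxes.
Context {d : nat}.
Implicit Types (s : seq (site d)) (w : config d) (v : site d).

Definition box (N : nat) : seq (site d) := undup (pmap pickle_inv (iota 0 N)).

Lemma box_uniq N : uniq (box N).
Proof. exact: undup_uniq. Qed.

Lemma mem_box N v : (v \in box N) = (pickle v < N)%N.
Proof.
rewrite mem_undup mem_pmap; apply/mapP/idP => [[k]|vN].
  rewrite mem_iota add0n => /andP[_ kN] vk.
  by have := @pickle_invK (site d) k; rewrite -vk /= => ->.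
by exists (pickle v); rewrite ?pickleK_inv// mem_iota.
Qed.

Definition open_off s (w : site d -> bool) : site d -> bool :=
  fun x => w x || (x \notin s).

Definition dive v (m : nat) : set (config d) :=
  [set w | hits (eq^~ v) w (v.2 - m%:Z)].

Definition dive_in s v (m : nat) : set (config d) :=
  [set w | hits (eq^~ v) (open_off s w) (v.2 - m%:Z)].

Lemma le_open_off s s' w : {subset s <= s'} ->
  le_config (open_off s' w) (open_off s w).
Proof.
move=> ss x /orP[wx|xs]; rewrite /open_off ?wx//.
by rewrite (contra (ss x) xs) orbT.
Qed.

Lemma dive_in_determined s v m : determined_by s (dive_in s v m).
Proof.
move=> w w' ww; rewrite /dive_in /= (_ : open_off s w = open_off s w')//.
apply/funext => x; rewrite /open_off; case: (boolP (x \in s)) => [xs|];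
  rewrite ?orbT//.
by rewrite ww.
Qed.

Lemma dive_in_sub s s' v m : {subset s <= s'} ->
  dive_in s v m `<=` dive_in s' v m.
Proof. by move=> ss w; apply: hits_sub; exact: le_open_off. Qed.

Lemma dive_in_dive s v m : dive_in s v m `<=` dive v m.
Proof. by move=> w; apply: hits_sub => x wx; rewrite /open_off wx. Qed.

Lemma reach_box K w u : reach K w u -> exists N, reach K (open_off (box N) w) u.
Proof.
have box_le N N' : (N <= N')%N -> {subset box N <= box N'}.
  by move=> NN x; rewrite !mem_box => /leq_trans; exact.
elim=> {u} [u Ku|x k _ [N xN]|x y k _ [N xN] xy|x k _ [N xN] xk].
- by exists 0%N; exact: reach_start.
- by exists N; exact: reach_up.
- by exists N; exact: reach_side xy.
- exists (maxn N (pickle (x, k)).+1); apply: reach_down.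
    by apply: reach_sub xN; apply: le_open_off; apply: box_le; exact: leq_maxl.
  by rewrite /open_off (negbTE xk) mem_box negbK leq_maxr.
Qed.

Lemma dive_bigcup v m : dive v m = \bigcup_N dive_in (box N) v m.
Proof.
apply/seteqP; split=> w.
  by move=> [u /reach_box [N uN] um]; exists N => //; exists u.
by move=> [N _]; exact: dive_in_dive.
Qed.

Lemma measurable_dive_in s v m : measurable (dive_in s v m).
Proof. exact: determined_measurable (@dive_in_determined s v m). Qed.

Lemma measurable_dive v m : measurable (dive v m).
Proof.
by rewrite dive_bigcup; apply: bigcupT_measurable => N;
  exact: measurable_dive_in.
Qed.

Context {R : realType} (p : R) (P : probability (config d) R).
Context (hP : site_percolation_law p P).

Lemma probability_dive_in s v m : uniq s ->
  P (dive_in s v m) = (mean p s (hit (eq^~ v) (v.2 - m%:Z)) all_open)%:E.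
Proof.
move=> us.
rewrite (probability_cylinder hP all_open us (@dive_in_determined s v m)).
congr EFin; apply: eq_mean_off => w ws; rewrite /hit /dive_in /=.
rewrite (_ : open_off s w = w)//; apply/funext => x; rewrite /open_off.
by case: (boolP (x \in s)) => [|xs]; rewrite ?orbF ?orbT// ws.
Qed.

Lemma probability_dive_le v m (b : R) :
  (forall s, uniq s -> mean p s (hit (eq^~ v) (v.2 - m%:Z)) all_open <= b) ->
  (P (dive v m) <= b%:E)%E.
Proof.
move=> sb; rewrite dive_bigcup.
have mD N := measurable_dive_in (box N) v m.
have homoD :
    {homo (fun N => dive_in (box N) v m) : N N' / (N <= N')%N >-> (N <= N')%O}.
  move=> N N' NN; apply/subsetPset/dive_in_sub => x.
  by rewrite !mem_box => /leq_trans; exact.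
have cvD := @nondecreasing_cvg_mu _ _ _ P (fun N => dive_in (box N) v m)
  mD (bigcupT_measurable _ mD) homoD.
rewrite -(cvg_lim _ cvD)//; apply: lime_le.
  by apply/cvg_ex; eexists; exact: cvD.
apply: nearW => N /=; rewrite probability_dive_in ?box_uniq// lee_fin sb//.
exact: box_uniq.
Qed.

Lemma shift_uniq s v : uniq (map (+%R v) s) = uniq s.
Proof. by apply: map_inj_uniq; exact: addrI. Qed.

Lemma mean_hit_le s v m : uniq s ->
  ((mean p s (hit (eq^~ v) (v.2 - m%:Z)) all_open)%:E <= P (dive 0%R m))%E.
Proof.
move=> us; have -> : s = map (+%R v) (map (+%R (- v)) s).
  by rewrite -map_comp map_id_in// => x _ /=; rewrite addrA subrr add0r.
rewrite mean_shift -probability_dive_in ?shift_uniq//.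
apply: le_measure; rewrite ?inE;
  [exact: measurable_dive_in|exact: measurable_dive|].
exact: dive_in_dive.
Qed.

(** Both inequalities hold because finite sets of sites can be translated, and
    these finite sets exhaust the lattice. *)
Lemma probability_dive_shift v m : P (dive v m) = P (dive 0%R m).
Proof.
have fin u : P (dive u m) \is a fin_num.
  by apply: fin_num_measure; exact: measurable_dive.
apply/eqP; rewrite eq_le; apply/andP; split.
  rewrite -(fineK (fin 0)); apply: probability_dive_le => s us.
  by rewrite -lee_fin fineK// mean_hit_le.
rewrite -(fineK (fin v)); apply: probability_dive_le => s us.
rewrite -lee_fin fineK// -(mean_shift _ _ v) -probability_dive_in ?shift_uniq//.
apply: le_measure; rewrite ?inE;
  [exact: measurable_dive_in|exact: measurable_dive|].
exact: dive_in_dive.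
Qed.

End Boxes.

(** * Above the threshold *)

Section Supercritical.
Context {R : realType} {d : nat} (p : R) (P : probability (config d) R).
Context (hP : site_percolation_law p P) (LIP1 : P (LIP d) = 1%E).

Lemma groundedE (n : nat) :
  [set w : config d | grounded w (0, n%:Z)] = dive (0, n%:Z) n.
Proof. by rewrite /dive /= subrr. Qed.

Lemma measurable_LIP : measurable (LIP d).
Proof.
rewrite LIPE; apply: bigcupT_measurable => n.
rewrite (_ : [set w | _] = ~` dive (0, n%:Z) n); last by rewrite -groundedE.
by apply: measurableC; exact: measurable_dive.
Qed.

Lemma not_LIP0 : P (~` LIP d) = 0%E.
Proof.
by rewrite probability_setC ?LIP1 ?subee//; exact: measurable_LIP.
Qed.

Lemma iter_dive (w : config d) v (n : nat) :
  (forall u, dive u 1 w) -> dive v n w.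
Proof.
move=> H; elim: n v => [|n IHn] v.
  by exists v; [exact: reach_start|rewrite subr0].
have [u vu uv] := H v; have [x ux xu] := IHn u.
exists x; last by lia.
by apply: reach_trans ux => _ ->.
Qed.

(** Otherwise almost surely all sites, being countably many, would go down one
    level, and then every site would go down arbitrarily far. *)
Lemma probability_dive1 : (P (dive 0%R 1) < 1)%E.
Proof.
have md v := @measurable_dive d v 1.
rewrite lt_neqAle probability_le1// andbT; apply/eqP => d1.
pose v_ k : site d := odflt (0 : site d) (pickle_inv k).
have neg : P.-negligible (\bigcup_k ~` dive (v_ k) 1).
  apply: negligible_bigcup => k; exists (~` dive (v_ k) 1).
  split=> //; first exact: measurableC.
  transitivity (1 - P (dive (v_ k) 1))%E; first exact: probability_setC.
  by rewrite (probability_dive_shift hP) d1 subee.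
have : P.-negligible (LIP d).
  apply: negligibleS neg => w; rewrite LIPE => -[n _ /= nw].
  apply: contrapT => ndive; apply: nw.
  rewrite -[grounded _ _]/([set w | grounded w (0, n%:Z)] w) groundedE.
  apply: iter_dive => u; apply: contrapT => nu; apply: ndive.
  by exists (pickle u) => //; rewrite /= /v_ pickleK_inv.
rewrite negligibleP; last exact: measurable_LIP.
by move=> LIP0; have := LIP1; rewrite [LHS]LIP0 => /esym/eqP; rewrite onee_eq0.
Qed.

(** The events that [(0, n)] goes down [n] levels decrease to the complement of
    [LIP d], and have the same probabilities as for the origin. *)
Lemma dive_small (eps : R) : 0 < eps ->
  exists m, (P (dive 0%R m.+1) <= eps%:E)%E.
Proof.
move=> eps0; pose F n : set (config d) := dive (0, n%:Z) n.
have mF n : measurable (F n) by exact: measurable_dive.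
have homoF : {homo F : n m / (n <= m)%N >-> (m <= n)%O}.
  move=> n m nm; apply/subsetPset.
  rewrite /F -!groundedE -!(lowest_gtE R) => w /=.
  by apply: le_lt_trans; rewrite lee_fin ler_nat.
have PF0 : (P (F 0%N) < +oo)%E by rewrite ltey_eq fin_num_measure.
have cvF := @nonincreasing_cvg_mu _ _ _ P F PF0 mF (bigcapT_measurable mF)
  homoF.
have F0 : P (\bigcap_n F n) = 0%E.
  rewrite -not_LIP0 LIPE setC_bigcup; congr (P _); apply: eq_bigcapr => n _.
  rewrite /F -groundedE; apply/seteqP.
  by split=> w /=; [move=> gw; apply|exact: contrapT].
apply: contrapT => /forallNP big.
have : (eps%:E <= P (\bigcap_n F n))%E.
  rewrite -(cvg_lim _ cvF)//; apply: lime_ge.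
    by apply/cvg_ex; eexists; exact: cvF.
  apply: nearW => n; rewrite /= (probability_dive_shift hP).
  have /negP := big n; rewrite -ltNge => /ltW /le_trans; apply.
  apply: le_measure; rewrite ?inE;
    [exact: measurable_dive|exact: measurable_dive|].
  by move=> w; apply: hits_le; rewrite lerD2l lerN2 lez_nat.
by rewrite F0 lee_fin leNgt eps0.
Qed.

End Supercritical.

(** For large [n] half of the rate absorbs [C]; the finitely many other positive
    [n] are dealt with by [r < 1]. *)
Lemma exponential_rate (R : realType) (u : nat -> R) (a C r : R) :
  0 < a -> r < 1 -> u 0%N <= 1 -> (forall n, u n.+1 <= r) ->
  (forall n, u n <= C * expR (- (a *+ 2) * n%:R)) ->
  exists2 alpha, 0 < alpha & forall n, u n <= expR (- alpha * n%:R).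
Proof.
move=> a0 r1 u0 ur uC.
have [N CN] : exists N : nat, C <= expR (a * N%:R).
  exists (Num.bound `|C / a|); apply: le_trans (expR_ge1Dx _).
  have : C / a <= (Num.bound `|C / a|)%:R.
    by apply: le_trans (ler_norm _) (ltW (archi_boundP _)).
  by rewrite ler_pdivrMr// => CN; rewrite mulrC; lra.
exists (Num.min a ((1 - r) / N.+1%:R)).
  by rewrite lt_min a0 divr_gt0// subr_gt0.
set alpha := Num.min _ _.
case=> [|n]; first by rewrite mulr0 expR0.
have [nN|Nn] := ltnP n N.
  apply: le_trans (ur n) _; apply: le_trans (expR_ge1Dx _).
  have : alpha * n.+1%:R <= (1 - r) / N.+1%:R * N.+1%:R.
    apply: ler_pM => //.
    - by rewrite le_min ltW//= divr_ge0// subr_ge0 ltW.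
    - by rewrite ge_min lexx orbT.
    - by rewrite ler_nat ltnS ltnW.
  rewrite divfK ?pnatr_eq0// => H; lra.
apply: le_trans (uC _) _.
apply: (@le_trans _ _ (expR (a * n.+1%:R) * expR (- (a *+ 2) * n.+1%:R))).
  rewrite ler_wpM2r ?expR_ge0//; apply: le_trans CN _.
  by rewrite ler_expR; apply: ler_wpM2l; [exact: ltW|rewrite ler_nat leqW].
rewrite -expRD ler_expR -mulrDl ler_wpM2r//.
have : alpha <= a by rewrite ge_min lexx.
lra.
Qed.

Theorem theorem2 (R : realType) (d : nat) (hd : (2 <= d)%N)
    (P : R -> probability (config d) R)
    (hP : forall p : R, 0 <= p <= 1 -> site_percolation_law p (P p))
    (pL : R) (hpL : is_pL P pL) :
  exists alpha : R -> R,
    (forall p : R, 0 <= p <= 1 -> pL < p -> 0 < alpha p) /\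
    (forall p : R, 0 <= p <= 1 -> forall n : nat,
       (P p [set w : config d | (n%:R)%:E < lowest_open_lipschitz R w 0%R]
        <= (expR (- alpha p * n%:R))%:E)%E).
Proof.
case: hpL => /andP[pL0 pL1] LIPp.
suff rate p : 0 <= p <= 1 -> pL < p -> exists2 alpha, 0 < alpha &
    forall n, (P p (dive 0%R n) <= (expR (- alpha * n%:R))%:E)%E.
  have choose p : exists alpha, (0 <= p <= 1 -> pL < p -> 0 < alpha) /\
      (0 <= p <= 1 -> forall n,
        (P p (dive 0%R n) <= (expR (- alpha * n%:R))%:E)%E).
    have [[p01 pLp]|np] := pselect (0 <= p <= 1 /\ pL < p).
      by have [alpha a0 aP] := rate p p01 pLp; exists alpha.
    exists 0; split=> [p01 pLp|p01 n]; first by case: np.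
    by rewrite oppr0 mul0r expR0 probability_le1//; exact: measurable_dive.
  have [alpha alphaP] := choice choose.
  exists alpha; split=> [p|p p01 n]; first by case: (alphaP p).
  rewrite lowest_gtE groundedE (probability_dive_shift (hP p p01)).
  by case: (alphaP p) => _; exact.
move=> p01 pLp; have /andP[p0 p1] := p01.
(* any parameter strictly between [pL] and [p] would do *)
pose p2 := (pL + p) / 2.
have p2p : p2 < p by rewrite /p2; lra.
have pLp2 : pL < p2 by rewrite /p2; lra.
have p201 : 0 <= p2 <= 1 by apply/andP; split; lra.
have LIP2 := (LIPp p2 p201).2 pLp2.
have LIP1 := (LIPp p p01).2 pLp.
(* [1 - p = (1 - p2) * (1 - delta)], and half of [delta] is left to each of the
   losses [t ^+ m.+1] and [1 - eps] *)
pose delta := (p - p2) / (1 - p2).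
have q0 : 0 < 1 - p2 by lra.
have delta0 : 0 < delta by rewrite divr_gt0// subr_gt0.
have delta1 : delta <= 1 by rewrite ler_pdivrMr//; lra.
have [m dm] := dive_small (hP p2 p201) LIP2 (divr_gt0 delta0 (ltr0Sn _ 1)).
pose a := delta / (4 * m.+1%:R).
have a0 : 0 < a by rewrite divr_gt0// mulr_gt0// ltr0Sn.
pose t := expR (- (a *+ 2)).
have t0 : 0 < t by exact: expR_gt0.
have t1 : t <= 1 by rewrite -expR0 ler_expR oppr_le0 mulrn_wge0// ltW.
have t01 : 0 <= t <= 1 by rewrite ltW.
have eps1 : delta / 2 <= 1 by lra.
have tE n : t ^+ n = expR (- (a *+ 2) * n%:R) by rewrite expRM_natr.
have tm : 1 - delta / 2 <= t ^+ m.+1.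
  rewrite tE; apply: le_trans (expR_ge1Dx _).
  have : a * m.+1%:R = delta / 4 by rewrite /a invfM mulrA divfK ?pnatr_eq0.
  by rewrite mulNr mulrnAl => ->; lra.
have large : 1 - p <= (1 - p2) * (t ^+ m.+1 * (1 - delta / 2)).
  have -> : 1 - p = (1 - p2) * (1 - delta).
    by rewrite mulrBr mulr1 /delta mulrCA divff ?gt_eqF// mulr1; ring.
  apply: ler_wpM2l; first exact: ltW.
  apply: (@le_trans _ _ ((1 - delta / 2) * (1 - delta / 2))).
    by rewrite -subr_ge0; have := sqr_ge0 delta; rewrite expr2; lra.
  by rewrite ler_wpM2r// subr_ge0.
have heps (u : site d) (s : seq (site d)) : uniq s ->
    mean p2 s (hit (eq^~ u) (u.2 - m.+1%:Z)) all_open <= delta / 2.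
  by move=> us; rewrite -lee_fin; apply: le_trans dm;
    exact: (mean_hit_le (hP p2 p201)).
pose Z := t ^+ m * (1 - delta / 2).
have Z0 : 0 < Z by rewrite mulr_gt0 ?exprn_gt0//; lra.
have fin n : P p (dive 0%R n) \is a fin_num.
  by apply: fin_num_measure; exact: measurable_dive.
have tail n : fine (P p (dive 0%R n)) <= Z^-1 * expR (- (a *+ 2) * n%:R).
  rewrite -lee_fin fineK//; apply: (probability_dive_le (hP p p01)) => s us.
  rewrite mulrC ler_pdivlMr// -tE.
  exact: finite_tail p201 p01 t01 eps1 heps large us.
have d1 := probability_dive1 (hP p p01) LIP1.
have [||n|alpha alpha0 alphaP] := exponential_rate
  (u := fun n => fine (P p (dive 0%R n))) (r := fine (P p (dive 0%R 1))) a0 _ _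
    _ tail.
- by rewrite -lte_fin fineK.
- by rewrite -lee_fin fineK// probability_le1//; exact: measurable_dive.
- rewrite fine_le//; apply: le_measure; rewrite ?inE;
    [exact: measurable_dive|exact: measurable_dive|].
  by move=> w; apply: hits_le; rewrite lerD2l lerN2 lez_nat.
by exists alpha => // n; rewrite -(fineK (fin n)) lee_fin.
Qed.
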